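(* Let $(\Omega,\mu)$ be a complete measure space with $\mu(\Omega)=\infty$, let $T$ be a Dunford-Schwartz operator on $\mathcal L^1+\mathcal L^\infty$, and let $\overline\beta=\{\beta_k\}_{k=0}^\infty$ be a good weight for $T$. Assume that $E$ is a fully symmetric space on $(\Omega,\mu)$ with $\mathbf 1=\chi_\Omega\notin E$. If $f\in E$, then the weighted averages $$a_n(\overline\beta,f)=\frac1n\sum_{k=0}^{n-1}\beta_kT^k(f)$$ converge almost everywhere to some $\widehat f\in E$.
   Context: Functions are complex-valued and identified when equal a.e. For $f\in\mathcal L^1+\mathcal L^\infty$ the non-increasing rearrangement is $\mu_t(f)=\inf\{\lambda>0:\mu\{|f|>\lambda\}\le t\}$, $t>0$. A Banach space $(E,\|\cdot\|_E)$ that is a linear subspace of $\mathcal L^1+\mathcal L^\infty$ is called fully symmetric if $f\in E$, $g\in\mathcal L^1+\mathcal L^\infty$ and $\int_0^s\mu_t(g)\,dt\le\int_0^s\mu_t(f)\,dt$ for all $s>0$ imply $g\in E$ and $\|g\|_E\le\|f\|_E$. A linear operator $T:\mathcal L^1+\mathcal L^\infty\to\mathcal L^1+\mathcal L^\infty$ is a Dunford-Schwartz operator if $\|T(f)\|_1\le\|f\|_1$ for all $f\in\mathcal L^1$ and $\|T(f)\|_\infty\le\|f\|_\infty$ for all $f\in\mathcal L^\infty$. A bounded sequence $\overline\beta=\{\beta_k\}_{k=0}^\infty$ of complex numbers is a good weight for $T$ if the sequence $\frac1n\sum_{k=0}^{n-1}\beta_kT^k(f)$ converges $\mu$-a.e.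 for every $f\in\mathcal L^1$. *)

(* Defs.v *)
From HB Require Import structures.
From mathcomp Require Import all_boot all_order all_algebra.
From mathcomp Require Import all_classical all_reals all_analysis.
From mathcomp Require Import complex.
Set Implicit Arguments.
Unset Strict Implicit.
Unset Printing Implicit Defensive.
Import Order.TTheory GRing.Theory Num.Theory.
Import numFieldNormedType.Exports.
Local Open Scope classical_set_scope.
Local Open Scope ring_scope.

(* Elements of the function spaces (classes modulo a.e. equality) are handled
   through representatives Omega -> R[i]; operators, spaces and norms on classes
   are therefore required below to be compatible with a.e. equality, and the
   algebraic identities between values of an operator hold a.e. *)

Section Defs.
Context {R : realType} {d : measure_display} {Omega : measurableType d}.
Variable mu : {measure set Omega -> \bar R}.
Implicit Types (f g : Omega -> R[i]) (beta : nat -> R[i]).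

Definition cmodulus (z : R[i]) : R := Normc.normc z.

Definition cmeasurable f : Prop :=
  measurable_fun setT (fun x => complex.Re (f x)) /\
  measurable_fun setT (fun x => complex.Im (f x)).

Definition cLnorm (p : \bar R) f : \bar R :=
  Lnorm mu p (fun x => (cmodulus (f x))%:E).

Definition cLfun (p : \bar R) f : Prop :=
  cmeasurable f /\ (cLnorm p f < +oo)%E.

Definition L1Linf f : Prop :=
  exists g h, [/\ cLfun 1%E g, cLfun +oo%E h & f = g \+ h].

(* The infimum is taken in \bar R, so that it is +oo (not 0) if no lambda
   qualifies; this does not occur for f in L1 + Linf and t > 0. *)
Definition rearrangement f (t : R) : \bar R :=
  ereal_inf [set lambda%:E | lambda in
    [set lambda : R | 0 < lambda /\
       (mu [set x | (lambda < cmodulus (f x))%R] <= t%:E)%E]].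

Definition submajorized g f : Prop :=
  forall s : R, 0 < s ->
    (\int[lebesgue_measure]_(t in `]0%R, s]) rearrangement g t <=
     \int[lebesgue_measure]_(t in `]0%R, s]) rearrangement f t)%E.

Record banach_subspace (E : set (Omega -> R[i]))
    (N : (Omega -> R[i]) -> R) : Prop := {
  bs_sub : E `<=` L1Linf ;
  bs_congr : forall f g, E f -> L1Linf g -> f = g %[ae mu] ->
    E g /\ N g = N f ;
  bs_zero : E (fun=> 0) ;
  bs_lin : forall (a : R[i]) f g, E f -> E g -> E ((a \*o f) \+ g) ;
  bs_norm_ge0 : forall f, E f -> 0 <= N f ;
  bs_norm_eq0 : forall f, E f -> N f = 0 -> f = (fun=> 0) %[ae mu] ;
  bs_normZ : forall (a : R[i]) f, E f -> N (a \*o f) = cmodulus a * N f ;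
  bs_normD : forall f g, E f -> E g -> N (f \+ g) <= N f + N g ;
  bs_complete : forall u : nat -> Omega -> R[i], (forall n, E (u n)) ->
    (forall e : R, 0 < e -> exists n0 : nat, forall m n : nat,
       (n0 <= m)%N -> (n0 <= n)%N -> N (u m \- u n) < e) ->
    exists2 l, E l & N (u n \- l) @[n --> \oo] --> (0 : R) }.

Definition fully_symmetric (E : set (Omega -> R[i]))
    (N : (Omega -> R[i]) -> R) : Prop :=
  banach_subspace E N /\
  forall f g, E f -> L1Linf g -> submajorized g f -> E g /\ N g <= N f.

(* The values of T outside L1 + Linf are irrelevant. *)
Record dunford_schwartz (T : (Omega -> R[i]) -> (Omega -> R[i])) : Prop := {
  ds_maps : forall f, L1Linf f -> L1Linf (T f) ;
  ds_congr : forall f g, L1Linf f -> L1Linf g -> f = g %[ae mu] ->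
    T f = T g %[ae mu] ;
  ds_lin : forall (a : R[i]) f g, L1Linf f -> L1Linf g ->
    T ((a \*o f) \+ g) = (a \*o T f) \+ T g %[ae mu] ;
  ds_L1 : forall f, cLfun 1%E f -> (cLnorm 1%E (T f) <= cLnorm 1%E f)%E ;
  ds_Linf : forall f, cLfun +oo%E f ->
    (cLnorm +oo%E (T f) <= cLnorm +oo%E f)%E }.

Definition weighted_average (T : (Omega -> R[i]) -> (Omega -> R[i])) beta
    f (n : nat) (x : Omega) : R[i] :=
  n%:R^-1 * \sum_(k < n) beta k * iter k T f x.

(* R[i]^o is R[i] with the topology of its modulus. *)
Definition good_weight (T : (Omega -> R[i]) -> (Omega -> R[i])) beta : Prop :=
  (exists C : R, forall k, cmodulus (beta k) <= C) /\
  forall f, cLfun 1%E f ->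
    \forall x \ae mu, cvgn (fun n => weighted_average T beta f n x : R[i]^o).

End Defs.

(* Main.v *)
Require Import Defs.
From HB Require Import structures.
From mathcomp Require Import all_boot all_order all_algebra.
From mathcomp Require Import all_classical all_reals all_analysis.
From mathcomp Require Import measurable_realfun ess_sup_inf complex.
From mathcomp Require Import lra.
Import Order.TTheory GRing.Theory Num.Theory.
Import numFieldNormedType.Exports.
Local Open Scope classical_set_scope.
Local Open Scope ring_scope.
Set Implicit Arguments.
Unset Strict Implicit.
Unset Printing Implicit Defensive.

(* Since 1 is not in E, every f in E has |{|f| > l}| finite for all l > 0;
   hence for l > 0 the radial truncation g = (|f| - l)^+ sgn f is integrable,
   while |f - g| <= l. By linearity the averages of f are, a.e. and uniformly
   in n, within C l of the convergent averages of g (C bounding the weights),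
   so they are a.e. Cauchy.
   For membership of the limit in E, the integral of the rearrangement of f
   over ]0, s] is the K-functional of f: the smallest value of ||g||_1 + s M
   over decompositions f = g + h with |h| <= M. The truncation at the height
   of the rearrangement at s is optimal. Rescaling to C = 1, the averages and
   (by Fatou) their limit split into parts bounded by the same ||g||_1 and M,
   so the limit is submajorized by f. Rearrangements are compared with
   functions on Omega through their distribution functions; no Tonelli theorem
   is used, as mu need not be sigma-finite. *)

(** * Comparison of integrals through distribution functions *)

Lemma step_sum_ge (R : realDomainType) (h y : R) (K : nat) : 0 <= h ->
  Num.min y (K.+1%:R * h) - h <= \sum_(k < K) h * (k.+1%:R * h < y)%R%:R.
Proof.
move=> h0; elim: K => [|K IH].
  by rewrite big_ord0 mul1r subr_le0 ge_min lexx orbT.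
rewrite big_ord_recr /=; case: (ltP (K.+1%:R * h) y) => Ky.
  rewrite mulr1 (le_trans (_ : _ <= K.+2%:R * h - h)) //.
    by rewrite lerD2r ge_min lexx orbT.
  move: IH; rewrite (min_idPr (ltW Ky)) -!natr1; lra.
by rewrite mulr0 addr0 (le_trans _ IH)// (min_idPl Ky) lerD2r ge_min lexx.
Qed.

Lemma step_sum_le (R : realDomainType) (h y : R) (K : nat) : 0 <= h -> 0 <= y ->
  \sum_(k < K) h * (k.+1%:R * h <= y)%R%:R <= Num.min y (K%:R * h).
Proof.
move=> h0 y0; elim: K => [|K IH]; first by rewrite big_ord0 mul0r le_min y0 lexx.
rewrite big_ord_recr /=; case: (lerP (K.+1%:R * h) y) => Ky.
  rewrite mulr1 -natr1 mulrDl mul1r lerD2r.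
  by rewrite (le_trans IH)// ge_min lexx orbT.
by rewrite mulr0 addr0 (le_trans IH)// ge_min lexx.
Qed.

Section integral_distribution.
Context {R : realType}.
Local Open Scope ereal_scope.

(** With [P l] the ray above [l], this is a Riemann sum for the layer-cake formula: [y] is the
    integral over [l > 0] of the indicator that [y] lies above [l]. The mesh is [1 / (n + 1)], and
    the [(n + 1) ^ 2] steps reach up to the height [n + 1], so that mesh and range improve
    together. *)
Definition step_approx (P : R -> set (\bar R)) (n : nat) (y : \bar R) : \bar R :=
  let h := (n.+1%:R^-1)%R in
  \sum_(k < n.+1 ^ 2) h%:E * (\1_(P (k.+1%:R * h)%R) y)%:E.

Let upo (l : R) := [set y : \bar R | l%:E < y].
Let upc (l : R) := [set y : \bar R | l%:E <= y].

Let in_upo l y : (y \in upo l) = (l%:E < y).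
Proof. by apply/idP/idP; rewrite inE. Qed.

Let in_upc l y : (y \in upc l) = (l%:E <= y).
Proof. by apply/idP/idP; rewrite inE. Qed.

Lemma step_approx_ge0 P n y : 0 <= step_approx P n y.
Proof.
by apply: sume_ge0 => k _; rewrite -EFinM lee_fin mulr_ge0 ?invr_ge0 ?ler0n.
Qed.

Lemma step_approx_upc_le n (y : \bar R) : 0 <= y -> step_approx upc n y <= y.
Proof.
case: y => [y| |]//; last by rewrite !leey.
rewrite lee_fin => y0; rewrite /step_approx.
rewrite [leLHS](_ : _ = (\sum_(k < n.+1 ^ 2) n.+1%:R^-1 *
    (k.+1%:R * n.+1%:R^-1 <= y)%R%:R)%:E).
  by rewrite lee_fin (le_trans (step_sum_le _ _ y0)) ?invr_ge0// ge_min lexx.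
by rewrite -sumEFin; apply: eq_bigr => k _; rewrite indicE in_upc lee_fin EFinM.
Qed.

(** For finite [y] the error is at most one mesh width as soon as the range exceeds [y]; at [+oo]
    every step counts and the sum is [n + 1]. *)
Lemma step_approx_upo_cvg (y : \bar R) : 0 <= y ->
  step_approx upo n y @[n --> \oo] --> y.
Proof.
case: y => [y| |]//; last first.
  move=> _; rewrite [X in X @ _](_ : _ = fun n : nat => n.+1%:R%:E).
    apply/cvgeryP/cvgryPge => M; near=> n.
    by rewrite (@le_trans _ _ n%:R)// ?ler_nat//; near: n; exact: nbhs_infty_ger.
  apply/funext => n; rewrite /step_approx.
  under eq_bigr do rewrite indicE in_upo ltry mule1.
  rewrite sumEFin sumr_const card_ord; congr EFin.
  by rewrite -(mulr_natr _ (n.+1 ^ 2)) natrX expr2 mulKf// pnatr_eq0.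
rewrite lee_fin => y0; rewrite [X in X @ _](_ : _ = fun n => (\sum_(k < n.+1 ^ 2)
    n.+1%:R^-1 * (k.+1%:R * n.+1%:R^-1 < y)%R%:R)%:E); last first.
  apply/funext => n; rewrite /step_approx -sumEFin; apply: eq_bigr => k _.
  by rewrite indicE in_upo lte_fin EFinM.
apply: cvg_EFin; first exact: nearW.
apply: (@squeeze_cvgr _ _ _ _ (fun n => y - n.+1%:R^-1)%R (fun=> y)).
- near=> n; apply/andP; split.
    have h0 : (0 <= n.+1%:R^-1 :> R)%R by rewrite invr_ge0.
    have := @step_sum_ge _ _ y (n.+1 ^ 2) h0.
    rewrite (min_idPl _)//.
    rewrite (@le_trans _ _ n%:R)//; first by near: n; exact: nbhs_infty_ger.
    rewrite ler_pdivlMr ?ltr0n// -natrM ler_nat -mulnn.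
    by rewrite (leq_trans _ (leqnSn _))// leq_mul2r/= leqnSn.
  have h0 : (0 <= n.+1%:R^-1 :> R)%R by rewrite invr_ge0.
  have := step_sum_le (n.+1 ^ 2) h0 y0.
  rewrite le_min => /andP[+ _]; apply: le_trans.
  apply: ler_sum => k _; rewrite ler_wpM2l// ler_nat.
  by case: ltP => [/ltW ->|].
- rewrite -[X in _ --> X]subr0; apply: cvgB; first exact: cvg_cst.
  exact: cvg_harmonic.
- exact: cvg_cst.
Unshelve. all: by end_near. Qed.

Lemma integral_step_approx d (T : measurableType d)
  (mu : {measure set T -> \bar R}) D (F : T -> \bar R) (P : R -> set (\bar R)) n :
  measurable D -> measurable_fun D F -> (forall l, measurable (P l)) ->
  \int[mu]_(x in D) step_approx P n (F x) =
  \sum_(k < n.+1 ^ 2) (n.+1%:R^-1)%:E *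
    mu (D `&` F @^-1` P (k.+1%:R * n.+1%:R^-1)%R).
Proof.
move=> mD mF mP.
have mPF l : measurable_fun D (fun x => (\1_(P l) (F x))%:E : \bar R).
  apply/measurable_EFinP; apply: (measurable_comp measurableT) => //.
rewrite ge0_integral_sum//; last first.
- by move=> k; apply: measurable_funeM; exact: mPF.
apply: eq_bigr => k _; rewrite ge0_integralZl_EFin ?invr_ge0//.
congr (_ * _); set l := (_ * _)%R.
rewrite [LHS](_ : _ = \int[mu]_(x in D) (\1_(D `&` F @^-1` P l) x)%:E); last first.
  apply: eq_integral => x xD; rewrite !indicE; congr (_%:R%:E).
  by rewrite in_setI xD.
by rewrite integral_indic; [rewrite setIAC setIid | exact: mD | exact: mF].
Qed.

(** Integrating the step approximations turns both sides into the same Riemann sum of the two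
    distribution functions, which are compared term by term. Strict levels on the left and weak
    levels on the right keep the assumption as weak as possible, so endpoints of intervals are
    harmless in the applications. *)
Lemma le_integral_distribution d1 (T1 : measurableType d1)
  d2 (T2 : measurableType d2) (mu : {measure set T1 -> \bar R})
  (nu : {measure set T2 -> \bar R}) D1 D2 (F : T1 -> \bar R) (G : T2 -> \bar R) :
  measurable D1 -> measurable D2 ->
  measurable_fun D1 F -> measurable_fun D2 G ->
  (forall x, D1 x -> 0 <= F x) -> (forall x, D2 x -> 0 <= G x) ->
  (forall l : R, (0 < l)%R -> mu (D1 `&` [set x | l%:E < F x]) <=
                         nu (D2 `&` [set x | l%:E <= G x])) ->
  \int[mu]_(x in D1) F x <= \int[nu]_(x in D2) G x.
Proof.
move=> mD1 mD2 mF mG F0 G0 FG.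
have mo l : measurable (upo l).
  rewrite [X in measurable X](_ : _ = `]l%:E, +oo[%classic).
    exact: emeasurable_itv.
  by apply/seteqP; split=> y; rewrite /upo/= in_itv/= andbT.
have mc l : measurable (upc l).
  rewrite [X in measurable X](_ : _ = `[l%:E, +oo[%classic).
    exact: emeasurable_itv.
  by apply/seteqP; split=> y; rewrite /upc/= in_itv/= andbT.
have mS (P : R -> set (\bar R)) d (T : measurableType d) D (H : T -> \bar R) n :
    (forall l, measurable (P l)) -> measurable D -> measurable_fun D H ->
    measurable_fun D (fun x => step_approx P n (H x)).
  move=> mP mD mH; apply: emeasurable_sum => k; apply: measurable_funeM.
  by apply/measurable_EFinP; apply: (measurable_comp measurableT).
(* The meshes are not nested, so the approximations need not increase with [n]; Fatou's lemma takes
   the place of monotone convergence. *)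
have -> : \int[mu]_(x in D1) F x =
    \int[mu]_(x in D1) limn_einf (fun n => step_approx upo n (F x)).
  apply: eq_integral => x /set_mem D1x.
  by rewrite (cvg_limn_einf_sup (step_approx_upo_cvg (F0 _ D1x))).
apply: le_trans; first apply: fatou => //.
- by move=> n; exact: mS.
- by move=> n x _; exact: step_approx_ge0.
rewrite limn_einf_lim; apply: lime_le; first exact: is_cvg_einfs.
apply: nearW => n; apply: (@le_trans _ _
  (\int[mu]_(x in D1) step_approx upo n (F x))).
  by apply: ereal_inf_lbound => /=; exists n => /=.
rewrite integral_step_approx//.
apply: (@le_trans _ _ (\int[nu]_(x in D2) step_approx upc n (G x))); last first.
  apply: ge0_le_integral => //; first by move=> x _; exact: step_approx_ge0.
    exact: mS.
  by move=> x D2x; exact/step_approx_upc_le/G0.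
rewrite integral_step_approx//; apply: lee_sum => k _.
by rewrite lee_wpmul2l ?lee_fin ?invr_ge0//; apply: FG; rewrite mulr_gt0 ?invr_gt0.
Qed.

End integral_distribution.

(** * The modulus of complex numbers *)

Section complex_modulus.
Context {R : realType}.
Implicit Types (z w : R[i]) (r : R).

Lemma cmodulus_ge0 z : 0 <= cmodulus z.
Proof. by case: z => a b; exact: sqrtr_ge0. Qed.

Lemma cmodulus0 : cmodulus (0 : R[i]) = 0.
Proof. exact: Normc.normc0. Qed.

Lemma cmodulusD z w : cmodulus (z + w) <= cmodulus z + cmodulus w.
Proof. exact: le_normcD. Qed.

Lemma cmodulusM z w : cmodulus (z * w) = cmodulus z * cmodulus w.
Proof. exact: Normc.normcM. Qed.

Lemma cmodulusN z : cmodulus (- z) = cmodulus z.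
Proof. exact: normcN. Qed.

Lemma cmodulus_real r : cmodulus (r%:C%C) = `|r|.
Proof. by rewrite /cmodulus /= expr0n addr0 sqrtr_sqr. Qed.

Lemma cmodulus_sum (I : Type) (s : seq I) (F : I -> R[i]) :
  cmodulus (\sum_(i <- s) F i) <= \sum_(i <- s) cmodulus (F i).
Proof.
elim: s => [|i s IH]; first by rewrite !big_nil cmodulus0.
by rewrite !big_cons (le_trans (cmodulusD _ _))// lerD2l.
Qed.

Lemma Re_le_cmodulus z : `|complex.Re z| <= cmodulus z.
Proof.
case: z => a b; rewrite /cmodulus/= -sqrtr_sqr ler_sqrt ?lerDl ?sqr_ge0//.
by rewrite addr_ge0 ?sqr_ge0.
Qed.

Lemma Im_le_cmodulus z : `|complex.Im z| <= cmodulus z.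
Proof.
case: z => a b; rewrite /cmodulus/= -sqrtr_sqr ler_sqrt ?lerDr ?sqr_ge0//.
by rewrite addr_ge0 ?sqr_ge0.
Qed.

Lemma cmodulus_le_ReIm z : cmodulus z <= `|complex.Re z| + `|complex.Im z|.
Proof.
have -> : z = (complex.Re z)%:C%C + 'i%C * (complex.Im z)%:C%C by exact: complexE.
rewrite (le_trans (cmodulusD _ _))// cmodulusM !cmodulus_real.
rewrite (_ : cmodulus 'i%C = 1) ?mul1r; last first.
  by rewrite /cmodulus/= expr0n add0r expr1n sqrtr1.
by rewrite /= !(mul0r, mulr0, mul1r, addr0, add0r, subr0, oppr0).
Qed.

End complex_modulus.

(** * Rearrangements and the two inequalities for the K-functional *)

Section rearrangement.
Context {R : realType} {d : measure_display} {Omega : measurableType d}.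
Variable mu : {measure set Omega -> \bar R}.
Implicit Types (f g : Omega -> R[i]).

Lemma measurable_cmodulus f : cmeasurable f ->
  measurable_fun setT (fun x => cmodulus (f x)).
Proof.
move=> [mr mi].
have -> : (fun x => cmodulus (f x)) = (fun x =>
    Num.sqrt (complex.Re (f x) ^+ 2 + complex.Im (f x) ^+ 2)).
  by apply/funext => x; rewrite /cmodulus; case: (f x).
apply: measurableT_comp.
  by apply: continuous_measurable_fun; apply: sqrt_continuous.
by apply: measurable_funD; exact: measurable_funX.
Qed.

Lemma measurable_cmodulus_gt f l : cmeasurable f ->
  measurable [set x | l < cmodulus (f x)].
Proof.
move=> /measurable_cmodulus mf.
rewrite [X in measurable X](_ : _ =
    setT `&` (fun x => cmodulus (f x)) @^-1` `]l, +oo[%classic); first exact: mf.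
by rewrite setTI; apply/seteqP; split=> x; rewrite /= in_itv/= andbT.
Qed.

Local Open Scope ereal_scope.

Lemma ae_le_measure (A B : set Omega) : measurable A -> measurable B ->
  (\forall x \ae mu, A x -> B x) -> mu A <= mu B.
Proof.
move=> mA mB [N [mN N0 AB]].
rewrite (@le_trans _ _ (mu (B `|` N)))//.
  rewrite le_measure ?inE//; first exact: measurableU.
  move=> x Ax; case: (pselect (B x)) => [|nBx]; [by left|right].
  by apply: AB => /= ABx; exact/nBx/ABx.
have : mu (B `|` N) <= mu B + mu N by exact: measureU2.
by rewrite [mu N]N0 adde0.
Qed.

Lemma rearrangement_ge0 f t : 0 <= rearrangement mu f t.
Proof. by apply: le_ereal_inf_tmp => _ [l [l0 _] <-]; rewrite lee_fin ltW. Qed.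

Lemma rearrangement_le f (l t : R) : (0 < l)%R ->
  mu [set x | (l < cmodulus (f x))%R] <= t%:E -> rearrangement mu f t <= l%:E.
Proof. by move=> l0 lt; apply: ereal_inf_lbound; exists l. Qed.

Lemma rearrangement_gt f (l t : R) : (0 < l)%R ->
  l%:E < rearrangement mu f t -> t%:E < mu [set x | (l < cmodulus (f x))%R].
Proof. by move=> l0; apply: contraTT; rewrite -!leNgt; exact: rearrangement_le. Qed.

(** Lowering the height enlarges the superlevel set, so no height below [l] is admissible. With
    [rearrangement_gt], this identifies the superlevel sets of the rearrangement, up to endpoints,
    as intervals starting at 0 whose length is the measure of the superlevel set of [|f|]. *)
Lemma rearrangement_ge f (l t : R) : cmeasurable f ->
  t%:E < mu [set x | (l < cmodulus (f x))%R] -> l%:E <= rearrangement mu f t.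
Proof.
move=> mf tl; apply: le_ereal_inf_tmp => _ [m [m0 mt] <-]; rewrite lee_fin leNgt.
apply/negP => ml; move: tl; rewrite ltNge => /negP; apply.
rewrite (le_trans _ mt)// le_measure ?inE//; [exact: measurable_cmodulus_gt..|].
by move=> x /=; exact: lt_trans.
Qed.

Lemma rearrangement_nonincreasing f (t u : R) : (t <= u)%R ->
  rearrangement mu f u <= rearrangement mu f t.
Proof.
move=> tu; apply: le_ereal_inf => _ [l [l0 lt] <-]; exists l => //; split=> //.
by rewrite (le_trans lt).
Qed.

Lemma measurable_rearrangement f (D : set R) : measurable D ->
  measurable_fun D (rearrangement mu f).
Proof.
move=> mD; apply: (measurability (@ErealGenCInfty.G R)) => [|/= _ [_] [r] -> <-].
  exact: ErealGenCInfty.measurableE.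
(* By monotonicity the preimage of a closed upper ray is an interval. *)
apply: measurableI => //; apply: is_interval_measurable => s t/=.
rewrite !in_itv/= !andbT => fs ft u /andP[su ut].
by rewrite in_itv/= andbT (le_trans ft)// rearrangement_nonincreasing.
Qed.

(** The truncation at the height [l] of the rearrangement at [s] attains the K-functional; this is
    the upper bound for its cost. On []0, s]] the rearrangement exceeds [l] by a function whose
    distribution dominates that of [(|f| - l)^+]. *)
Lemma truncation_le_integral_rearrangement f (s l : R) :
  cmeasurable f -> (0 < s)%R -> rearrangement mu f s = l%:E ->
  \int[mu]_x (Num.max (cmodulus (f x) - l) 0)%:E + (s * l)%:E <=
  \int[lebesgue_measure]_(t in `]0%R, s]) rearrangement mu f t.
Proof.
move=> mf s0 fs; have l0 : (0 <= l)%R by rewrite -lee_fin -fs rearrangement_ge0.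
have mr : measurable_fun `]0%R, s]%classic (rearrangement mu f).
  exact: measurable_rearrangement.
have rl t : `]0%R, s]%classic t -> l%:E <= rearrangement mu f t.
  by rewrite /= in_itv/= -fs => /andP[_ ts]; exact: rearrangement_nonincreasing.
have r0 t : `]0%R, s]%classic t -> 0 <= rearrangement mu f t - l%:E.
  by move=> /rl; rewrite sube_ge0.
have mrl : measurable_fun `]0%R, s]%classic (fun t => rearrangement mu f t - l%:E).
  by apply: emeasurable_funB => //.
(* The constant [l] is split off; over []0, s]] it contributes [s * l]. *)
have -> : \int[lebesgue_measure]_(t in `]0%R, s]) rearrangement mu f t =
    \int[lebesgue_measure]_(t in `]0%R, s]) (rearrangement mu f t - l%:E) + (s * l)%:E.
  under eq_integral do rewrite -[rearrangement _ _ _](@subeK _ _ l%:E)//.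
  rewrite ge0_integralD//=.
  rewrite integral_cst//= lebesgue_measure_itv/= lte_fin s0 oppr0 adde0.
  by rewrite -EFinM mulrC.
rewrite leeD2r//; apply: le_integral_distribution => //.
- apply/measurable_EFinP; apply: measurable_maxr => //.
  by apply: measurable_funB => //; exact: measurable_cmodulus.
- by move=> x _; rewrite lee_fin le_max lexx orbT.
move=> m m0.
rewrite setTI [X in mu X](_ : _ = [set x | (l + m < cmodulus (f x))%R]); last first.
  apply/seteqP; split=> x /=; rewrite lte_fin lt_max ltrBrDl.
    by rewrite (lt_gtF m0) orbF.
  by move=> ->.
set M := mu _.
(* Above the height [l] the superlevel set of [|f|] has measure at most [s], so the interval []0,
   M[] fits into []0, s]]. *)
have Ms : M <= s%:E.
  rewrite leNgt; apply/negP => /(rearrangement_ge mf); rewrite fs lee_fin.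
  by rewrite leNgt ltrDl m0.
have Mfin : M \is a fin_num.
  by rewrite ge0_fin_numE ?measure_ge0// (le_lt_trans Ms)// ltry.
rewrite (@le_trans _ _ (lebesgue_measure `]0%R, (fine M)[%classic))//.
  rewrite lebesgue_measure_itv/= lte_fin; case: ltP => M0.
    by rewrite oppr0 adde0 fineK.
  by rewrite -[M]fineK// lee_fin.
rewrite le_measure ?inE//.
  by have := emeasurable_fun_c_infty (measurable_itv `]0%R, s]) mrl m%:E.
move=> t; rewrite /= !in_itv/= => /andP[t0 tM]; rewrite t0/=; split.
  by rewrite ltW// (lt_le_trans tM)// -lee_fin fineK.
rewrite EFinN leeBrDr//= -EFinD addrC; apply: rearrangement_ge => //.
by rewrite -[ltRHS](fineK Mfin) lte_fin.
Qed.

(** The other half of the K-functional formula: every splitting into an integrable-type part [g] and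
    a part bounded by [M] costs at least the integral of the rearrangement. The excess of the
    rearrangement over [M] is distributed below [|g|]. *)
Lemma integral_rearrangement_le f g (s M : R) : cmeasurable f -> cmeasurable g ->
  (0 < s)%R -> (0 <= M)%R ->
  (\forall x \ae mu, cmodulus (f x) <= cmodulus (g x) + M)%R ->
  \int[lebesgue_measure]_(t in `]0%R, s]) rearrangement mu f t <=
  \int[mu]_x (cmodulus (g x))%:E + (s * M)%:E.
Proof.
move=> mf mg s0 M0 fg.
have mr : measurable_fun `]0%R, s]%classic (rearrangement mu f).
  exact: measurable_rearrangement.
(* The positive part is taken because the rearrangement may fall below [M] inside []0, s]]. *)
have mr0 : measurable_fun `]0%R, s]%classic
    (fun t => maxe (rearrangement mu f t - M%:E) 0).
  by apply: measurable_maxe => //; exact: emeasurable_funB.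
rewrite (@le_trans _ _ (\int[lebesgue_measure]_(t in `]0%R, s])
    (maxe (rearrangement mu f t - M%:E) 0 + M%:E)))//.
  apply: ge0_le_integral => //.
  - by move=> t _; exact: rearrangement_ge0.
  - exact: emeasurable_funD.
  - by move=> t _; rewrite -leeBlDr// le_max lexx.
rewrite ge0_integralD//=; last first.
  by move=> t _; rewrite le_max lexx orbT.
rewrite integral_cst//= lebesgue_measure_itv/= lte_fin s0 oppr0 adde0.
rewrite -EFinM mulrC leeD2r//; apply: le_integral_distribution => //.
- by apply/measurable_EFinP; exact: measurable_cmodulus.
- by move=> t _; rewrite le_max lexx orbT.
- by move=> x _; rewrite lee_fin cmodulus_ge0.
move=> m m0; rewrite setTI.
set A := _ `&` _; set B := [set x | _].
have mA : measurable A.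
  by have := emeasurable_fun_o_infty (measurable_itv `]0%R, s]) mr0 m%:E.
have mB : measurable B.
  have /measurable_EFinP := measurable_cmodulus mg.
  by move=> /(emeasurable_fun_c_infty measurableT)/(_ m%:E); rewrite setTI.
(* If the rearrangement at [t] exceeds [m + M], then [|f| > m + M] on a set of measure above [t],
   and there [|g| >= m] almost everywhere. *)
have AB t : A t -> (0 < t)%R /\ t%:E < mu B.
  rewrite /A/= in_itv/= => -[/andP[t0 _]]; rewrite lt_max [X in _ || X]ltNge.
  rewrite lee_fin (ltW m0) orbF EFinN lteBrDr// -EFinD => /rearrangement_gt.
  move=> /(_ (ltr_wpDr M0 m0)) tB; split=> //; apply: (lt_le_trans tB).
  apply: ae_le_measure => //; first exact: measurable_cmodulus_gt.
  apply: filterS fg => x fg /=; rewrite /B/= lee_fin; move: fg; lra.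
have [->|Boo] := eqVneq (mu B) +oo; first by rewrite leey.
have Bfin : mu B \is a fin_num by rewrite ge0_fin_numE ?measure_ge0// ltey.
rewrite (@le_trans _ _ (lebesgue_measure `]0%R, (fine (mu B))[%classic))//.
  rewrite le_measure ?inE//= => t /AB[t0 tB]/=.
  by rewrite in_itv/= t0/= -lte_fin fineK.
rewrite lebesgue_measure_itv/= lte_fin; case: ltP => B0.
  by rewrite oppr0 adde0 fineK.
exact: measure_ge0.
Qed.

End rearrangement.

(** * Limits of complex sequences *)

Section complex_limits.
Context {R : realType}.
Implicit Types (u v : nat -> R[i]) (l : R[i]).

Lemma cvg_cmodulusP u l : (u n @[n --> \oo] --> (l : R[i]^o)) <->
  (forall e : R, 0 < e -> \forall n \near \oo, cmodulus (l - u n) < e).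
Proof.
have cvgE := @cvgrPdist_lt R[i] R[i]^o nat \oo _ u l.
split=> [/cvgE ul e e0|ul].
  have /ul : 0 < e%:C%C by rewrite -[0]/(0%:C%C) ltcR.
  by apply: filterS => n; rewrite -ltcR.
apply/cvgE => e; rewrite ltcE/= => /andP[/eqP e0 /ul].
apply: filterS => n; rewrite (_ : e = (complex.Re e)%:C%C); last first.
  by move: e0; case: e => a b /= ->.
by rewrite ltcR.
Qed.

Lemma cvg_Re u l : (u n @[n --> \oo] --> (l : R[i]^o)) ->
  complex.Re (u n) @[n --> \oo] --> complex.Re l.
Proof.
move=> /cvg_cmodulusP ul; apply/cvgrPdist_lt => e /ul; apply: filterS => n.
by apply: le_lt_trans; rewrite -raddfB; exact: Re_le_cmodulus.
Qed.

Lemma cvg_Im u l : (u n @[n --> \oo] --> (l : R[i]^o)) ->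
  complex.Im (u n) @[n --> \oo] --> complex.Im l.
Proof.
move=> /cvg_cmodulusP ul; apply/cvgrPdist_lt => e /ul; apply: filterS => n.
by apply: le_lt_trans; rewrite -raddfB; exact: Im_le_cmodulus.
Qed.

Lemma cvg_Re_Im u l :
  complex.Re (u n) @[n --> \oo] --> complex.Re l ->
  complex.Im (u n) @[n --> \oo] --> complex.Im l ->
  u n @[n --> \oo] --> (l : R[i]^o).
Proof.
move=> /cvgrPdist_lt ur /cvgrPdist_lt ui; apply/cvg_cmodulusP => e e0.
have e2 : 0 < e / 2 by rewrite divr_gt0.
near=> n; rewrite (le_lt_trans (cmodulus_le_ReIm _))// [ltRHS]splitr !raddfB.
by apply: ltrD; near: n; [exact: ur|exact: ui].
Unshelve. all: by end_near. Qed.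

Lemma cvg_complexB u v l m : (u n @[n --> \oo] --> (l : R[i]^o)) ->
  (v n @[n --> \oo] --> (m : R[i]^o)) ->
  u n - v n @[n --> \oo] --> (l - m : R[i]^o).
Proof.
move=> ul vm; apply: cvg_Re_Im.
  under eq_fun do rewrite raddfB; rewrite raddfB.
  by apply: cvgB; exact: cvg_Re.
under eq_fun do rewrite raddfB; rewrite raddfB.
by apply: cvgB; exact: cvg_Im.
Qed.

Lemma cvg_complexZ (c : R[i]) u l : (u n @[n --> \oo] --> (l : R[i]^o)) ->
  c * u n @[n --> \oo] --> (c * l : R[i]^o).
Proof. exact: (@cvgZr R[i] R[i]^o). Qed.

Lemma cvg_cmodulus u l : (u n @[n --> \oo] --> (l : R[i]^o)) ->
  cmodulus (u n) @[n --> \oo] --> cmodulus l.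
Proof.
move=> /cvg_cmodulusP ul; apply/cvgrPdist_lt => e /ul; apply: filterS => n.
apply: le_lt_trans; rewrite ler_norml; apply/andP; split.
  by rewrite lerNl opprB lerBlDr -[cmodulus (l - _)]cmodulusN opprB
    (le_trans _ (cmodulusD _ _))// subrK.
by rewrite lerBlDr (le_trans _ (cmodulusD _ _))// subrK.
Qed.

(** A sequence uniformly close to convergent ones is Cauchy; completeness is applied to the real and
    imaginary parts separately. *)
Lemma is_cvg_approx u :
  (forall e : R, 0 < e -> exists2 v, cvgn (v : nat -> R[i]^o) &
    forall n, cmodulus (u n - v n) <= e) ->
  cvgn (u : nat -> R[i]^o).
Proof.
move=> uv.
have ul e : 0 < e -> exists l, \forall n \near \oo, cmodulus (l - u n) < e.
  move=> e0; have e2 : 0 < e / 2 by rewrite divr_gt0.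
  have [v /cvg_ex[l /cvg_cmodulusP vl] uve] := uv _ e2; exists l.
  apply: filterS (vl _ e2) => n vln; rewrite [ltRHS]splitr.
  rewrite -(subrK (v n) l) -addrA (le_lt_trans (cmodulusD _ _))// ltr_leD//.
  by rewrite -cmodulusN opprB.
have Re_cvg : cvgn (fun n => complex.Re (u n)).
  apply/cauchy_cvgP/cauchy_exP => e /ul[l le]; exists (complex.Re l).
  apply: filterS le => n /=; apply: le_lt_trans.
  by rewrite -raddfB; exact: Re_le_cmodulus.
have Im_cvg : cvgn (fun n => complex.Im (u n)).
  apply/cauchy_cvgP/cauchy_exP => e /ul[l le]; exists (complex.Im l).
  apply: filterS le => n /=; apply: le_lt_trans.
  by rewrite -raddfB; exact: Im_le_cmodulus.
move: Re_cvg Im_cvg => /cvg_ex[a ua] /cvg_ex[b ub].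
by apply/cvg_ex; exists (Complex a b); exact: cvg_Re_Im.
Qed.

End complex_limits.

(** * Measurability of complex functions and almost everywhere limits *)

Section cmeasurable_theory.
Context {R : realType} {d : measure_display} {Omega : measurableType d}.
Variable mu : {measure set Omega -> \bar R}.
Implicit Types (f g : Omega -> R[i]).

Lemma cmeasurable_cst (c : R[i]) : cmeasurable (fun _ : Omega => c).
Proof. by split; exact: measurable_cst. Qed.

Lemma cmeasurableD f g : cmeasurable f -> cmeasurable g -> cmeasurable (f \+ g).
Proof.
move=> [fr fi] [gr gi]; split; under eq_fun do rewrite /= raddfD;
  exact: measurable_funD.
Qed.

Lemma cmeasurableM f g : cmeasurable f -> cmeasurable g -> cmeasurable (f \* g).
Proof.
move=> [fr fi] [gr gi]; split.
  rewrite (_ : (fun _ => _) = (fun x => complex.Re (f x) * complex.Re (g x) -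
      complex.Im (f x) * complex.Im (g x))); last first.
    by apply/funext => x /=; case: (f x) (g x) => a b [c e].
  by apply: measurable_funB; exact: measurable_funM.
rewrite (_ : (fun _ => _) = (fun x => complex.Re (f x) * complex.Im (g x) +
    complex.Im (f x) * complex.Re (g x))); last first.
  by apply/funext => x /=; case: (f x) (g x) => a b [c e].
by apply: measurable_funD; exact: measurable_funM.
Qed.

Lemma cmeasurableB f g : cmeasurable f -> cmeasurable g -> cmeasurable (f \- g).
Proof.
move=> [fr fi] [gr gi]; split; under eq_fun do rewrite /= raddfB;
  exact: measurable_funB.
Qed.

Lemma cmeasurable_sum (I : Type) (s : seq I) (F : I -> Omega -> R[i]) :
  (forall i, cmeasurable (F i)) -> cmeasurable (fun x => \sum_(i <- s) F i x).
Proof.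
move=> mF; elim: s => [|i s IH].
  by under eq_fun do rewrite big_nil; exact: cmeasurable_cst.
by under eq_fun do rewrite big_cons; exact: cmeasurableD.
Qed.

Lemma cmeasurable_real (f : Omega -> R) : measurable_fun setT f ->
  cmeasurable (fun x => (f x)%:C%C).
Proof. by move=> mf; split=> //=; exact: measurable_cst. Qed.

Lemma cmeasurable_cvg (u : nat -> Omega -> R[i]) f :
  (forall n, cmeasurable (u n)) ->
  (forall x, u n x @[n --> \oo] --> (f x : R[i]^o)) -> cmeasurable f.
Proof.
move=> mu_ uf; split.
  apply: (@measurable_fun_cvg _ _ _ _ (fun n x => complex.Re (u n x))).
    by move=> n; case: (mu_ n).
  by move=> x _; exact: cvg_Re.
apply: (@measurable_fun_cvg _ _ _ _ (fun n x => complex.Im (u n x))).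
  by move=> n; case: (mu_ n).
by move=> x _; exact: cvg_Im.
Qed.

Local Open Scope ereal_scope.

(** The last clause is Fatou's lemma: a common bound on the integrals of the moduli passes to the
    limit. *)
Lemma ae_limit_cmeasurable (u : nat -> Omega -> R[i]) :
  (forall n, cmeasurable (u n)) ->
  (\forall x \ae mu, cvgn (fun n => u n x : R[i]^o)) ->
  exists2 f, cmeasurable f /\
    (\forall x \ae mu, u n x @[n --> \oo] --> (f x : R[i]^o)) &
    forall B : \bar R, (forall n, \int[mu]_x (cmodulus (u n x))%:E <= B) ->
      \int[mu]_x (cmodulus (f x))%:E <= B.
Proof.
move=> mu_ [N [mN N0 cvgN]].
(* Setting the functions to 0 on the exceptional null set makes them converge everywhere, so that
   the pointwise limit is measurable. *)
pose v (n : nat) (x : Omega) : R[i] := ((\1_(~` N) x)%:C%C * u n x)%R.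
pose f x : R[i] := lim (v n x @[n --> \oo] : set_system (R[i]^o)).
have mv n : cmeasurable (v n).
  apply: (cmeasurableM (f := fun x => (\1_(~` N) x)%:C%C)) => //.
  apply: cmeasurable_real.
  by apply: measurable_indic; exact: measurableC.
have vE n x : ~ N x -> v n x = u n x.
  by move=> Nx; rewrite /v/= indicE mem_set//= mul1r.
have v0 n x : N x -> v n x = 0%R.
  by move=> Nx; rewrite /v/= indicE memNset//= ?mul0r//; apply.
have vf x : v n x @[n --> \oo] --> (f x : R[i]^o).
  suff : cvgn (fun n => v n x : R[i]^o) by [].
  apply/cvg_ex; have [Nx|Nx] := pselect (N x).
    exists 0%R; rewrite [X in X @ _](_ : _ = fun=> 0%R); first exact: cvg_cst.
    by apply/funext => n; exact: v0.
  have : cvgn (fun n => u n x : R[i]^o).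
    by apply/not_notP => ux; apply/Nx/cvgN.
  move=> /cvg_ex[l ul]; exists l.
  by rewrite [X in X @ _](_ : _ = fun n => u n x)//; apply/funext => n; exact: vE.
exists f; first split; first exact: cmeasurable_cvg vf.
  exists N; split; [exact: mN | exact: N0 | move=> x /= ufx].
  apply/not_notP => Nx; apply: ufx.
  by have := vf x; under eq_fun do rewrite vE//.
move=> B uB; have -> : \int[mu]_x (cmodulus (f x))%:E =
    \int[mu]_x limn_einf (fun n => (cmodulus (v n x))%:E).
  apply: eq_integral => x _; apply/esym.
  have : (cmodulus (v n x))%:E @[n --> \oo] --> (cmodulus (f x))%:E.
    by apply: cvg_EFin; [exact: nearW|exact: cvg_cmodulus].
  by move=> /cvg_limn_einf_sup[].
have mcv n : measurable_fun setT (fun x => (cmodulus (v n x))%:E).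
  by apply/measurable_EFinP; exact: measurable_cmodulus.
apply: le_trans; first apply: fatou => //.
  by move=> n x _; rewrite lee_fin cmodulus_ge0.
rewrite limn_einf_lim; apply: lime_le; first exact: is_cvg_einfs.
apply: nearW => n; apply: (@le_trans _ _ (\int[mu]_x (cmodulus (v n x))%:E)).
  by apply: ereal_inf_lbound => /=; exists n => /=.
apply: (le_trans _ (uB n)); apply: ge0_le_integral => //.
- by move=> x _; rewrite lee_fin cmodulus_ge0.
- by apply/measurable_EFinP; exact: measurable_cmodulus.
move=> x _; rewrite lee_fin; have [Nx|Nx] := pselect (N x); last by rewrite vE.
by rewrite v0// cmodulus0 cmodulus_ge0.
Qed.

End cmeasurable_theory.

(** * Integrable and essentially bounded functions; radial truncation *)

Section truncation.
Context {R : realType} {d : measure_display} {Omega : measurableType d}.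
Variable mu : {measure set Omega -> \bar R}.
Hypothesis mu_gt0 : (0 < mu setT)%E.
Implicit Types (f g h : Omega -> R[i]) (l M : R).
Local Open Scope ereal_scope.

Lemma cLnorm1E f : cLnorm mu 1 f = \int[mu]_x (cmodulus (f x))%:E.
Proof.
rewrite /cLnorm Lnorm1; apply: eq_integral => x _.
by rewrite gee0_abs// lee_fin cmodulus_ge0.
Qed.

Lemma cLnormyP f (a : \bar R) :
  cLnorm mu +oo f <= a <-> \forall x \ae mu, (cmodulus (f x))%:E <= a.
Proof.
(* [Lnorm] at the exponent [+oo] is the essential supremum only on a space of positive measure, and
   0 otherwise. *)
rewrite /cLnorm unlock /= mu_gt0.
rewrite (_ : abse \o _ = fun x => (cmodulus (f x))%:E); last first.
  by apply/funext => x /=; rewrite ger0_norm// cmodulus_ge0.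
by split=> /ess_supP.
Qed.

Lemma cLfun1P f : cLfun mu 1 f <->
  cmeasurable f /\ \int[mu]_x (cmodulus (f x))%:E < +oo.
Proof. by rewrite /cLfun cLnorm1E. Qed.

Lemma cLfunyP f : cLfun mu +oo f <->
  cmeasurable f /\ exists M, \forall x \ae mu, (cmodulus (f x) <= M)%R.
Proof.
split=> -[mf].
  move=> foo; split=> //; exists (fine (cLnorm mu +oo f)).
  have : cLnorm mu +oo f <= (fine (cLnorm mu +oo f))%:E.
    by rewrite fineK// ge0_fin_numE// Lnorm_ge0.
  by move/cLnormyP; apply: filterS => x; rewrite lee_fin.
move=> [M fM]; split=> //; apply: (@le_lt_trans _ _ M%:E); last by rewrite ltry.
by apply/cLnormyP; apply: filterS fM => x; rewrite lee_fin.
Qed.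

Lemma cLfun_0 (p : \bar R) : p != 0 -> cLfun mu p (fun=> 0%R).
Proof.
move=> p0; split; first exact: cmeasurable_cst.
rewrite /cLnorm (_ : (fun _ => _) = cst 0) ?Lnorm0//.
by apply/funext => x; rewrite cmodulus0.
Qed.

Lemma cLfun1_L1Linf f : cLfun mu 1 f -> L1Linf mu f.
Proof.
move=> f1; exists f, (fun=> 0%R); split=> //; first exact: cLfun_0.
by apply/funext => x /=; rewrite addr0.
Qed.

Lemma cLfuny_L1Linf f : cLfun mu +oo f -> L1Linf mu f.
Proof.
move=> foo; exists (fun=> 0%R), f; split=> //.
  by apply: cLfun_0; rewrite eqe oner_eq0.
by apply/funext => x /=; rewrite add0r.
Qed.

Lemma L1Linf_cmeasurable f : L1Linf mu f -> cmeasurable f.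
Proof. by move=> [g [h [[mg _] [mh _] ->]]]; exact: cmeasurableD. Qed.

(* Where f vanishes the quotient is 0 / 0 = 0. *)
Definition truncation f l : Omega -> R[i] := fun x =>
  ((Num.max (cmodulus (f x) - l) 0 / cmodulus (f x))%:C%C * f x)%R.

Lemma cmodulus_truncation f l x : (0 <= l)%R ->
  cmodulus (truncation f l x) = Num.max (cmodulus (f x) - l)%R 0%R.
Proof.
move=> l0; rewrite /truncation cmodulusM cmodulus_real.
have [f0|f0] := eqVneq (cmodulus (f x)) 0%R.
  by rewrite f0 mulr0 sub0r (max_idPr _)// oppr_le0.
by rewrite ger0_norm ?divfK// divr_ge0 ?cmodulus_ge0// le_max lexx orbT.
Qed.

(** The difference is [(1 - c) f] with [0 <= c <= 1], and its modulus is [|f| - (|f| - l)^+], the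
    minimum of [|f|] and [l]. *)
Lemma cmodulus_sub_truncation f l x : (0 <= l)%R ->
  (cmodulus (f x - truncation f l x)%R <= l)%R.
Proof.
move=> l0; rewrite /truncation; set c := (_ / _)%R.
have c01 : (0 <= c <= 1)%R.
  have a0 := cmodulus_ge0 (f x).
  rewrite divr_ge0 ?le_max ?lexx ?orbT//=.
  have [f0|f0] := eqVneq (cmodulus (f x)) 0%R; first by rewrite /c f0 invr0 mulr0.
  rewrite ler_pdivrMr ?mul1r ?lt_neqAle 1?eq_sym ?f0// ge_max a0 andbT; lra.
rewrite -[X in (X - _)%R]mul1r -mulrBl -(rmorph1 (real_complex R)).
rewrite -rmorphB cmodulusM cmodulus_real ger0_norm; last by lra.
rewrite mulrBl mul1r.
have -> : (c * cmodulus (f x) = Num.max (cmodulus (f x) - l) 0)%R.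
  rewrite -(cmodulus_truncation f x l0) /truncation cmodulusM cmodulus_real.
  by rewrite ger0_norm//; case/andP: c01.
by rewrite lerBlDr -lerBlDl le_max lexx.
Qed.

Lemma cmeasurable_truncation f l : cmeasurable f -> cmeasurable (truncation f l).
Proof.
move=> mf; have mcf := measurable_cmodulus mf.
apply: (cmeasurableM (f := fun x =>
  ((Num.max (cmodulus (f x) - l) 0 / cmodulus (f x))%:C%C)%R)) => //.
apply: cmeasurable_real; apply: measurable_funM.
  by apply: measurable_maxr => //; exact: measurable_funB.
(* The inverse, with value 0 at 0, agrees on nonnegative reals with the power of exponent -1, whose
   measurability is known. *)
rewrite (_ : (fun _ => _) = (fun x => powR (cmodulus (f x)) (-1))); last first.
  by apply/funext => x; rewrite powR_inv1// cmodulus_ge0.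
by apply: (measurableT_comp (measurable_powR _)).
Qed.

(** Write [f = g + h] with [g] integrable and [|h| <= M]. The truncation vanishes off the set where
    [|f| > l], and on this set of finite measure it is at most [|g| + M]. *)
Lemma cLfun1_truncation f l : (0 <= l)%R -> L1Linf mu f ->
  mu [set x | (l < cmodulus (f x))%R] < +oo -> cLfun mu 1 (truncation f l).
Proof.
move=> l0 Lf fl; have mf := L1Linf_cmeasurable Lf.
have mA := measurable_cmodulus_gt l mf.
set A := [set x | _] in fl mA.
have [g [h [/cLfun1P[mg goo] /cLfunyP[mh [M hM]] fgh]]] := Lf.
apply/cLfun1P; split; first exact: cmeasurable_truncation.
have mcg := measurable_cmodulus mg.
pose M0 := Num.max M 0%R.
apply: (@le_lt_trans _ _
    (\int[mu]_x ((cmodulus (g x))%:E + M0%:E * (\1_A x)%:E))).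
  apply: ae_ge0_le_integral => //.
  - by move=> x _; rewrite lee_fin cmodulus_ge0.
  - apply/measurable_EFinP/measurable_cmodulus; exact: cmeasurable_truncation.
  - move=> x _; rewrite -EFinM -EFinD lee_fin addr_ge0 ?cmodulus_ge0//.
    by rewrite mulr_ge0// le_max lexx orbT.
  - apply: emeasurable_funD; first exact/measurable_EFinP.
    by apply: measurable_funeM; apply/measurable_EFinP; exact: measurable_indic.
  apply: filterS hM => x hM _; rewrite cmodulus_truncation// -EFinM -EFinD lee_fin.
  rewrite indicE; have [xA|xA] := boolP (x \in A).
    rewrite mulr1 ge_max addr_ge0 ?cmodulus_ge0 ?le_max ?lexx ?orbT// andbT.
    have := cmodulusD (g x) (h x); rewrite fgh /=.
    have : (M <= M0)%R by rewrite le_max lexx.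
    lra.
  rewrite mulr0 addr0 ge_max cmodulus_ge0 andbT.
  have := cmodulus_ge0 (g x); suff : (cmodulus (f x) <= l)%R by lra.
  by rewrite leNgt; apply: contra xA => xA; rewrite inE.
rewrite ge0_integralD//; last 4 first.
- by move=> x _; rewrite lee_fin cmodulus_ge0.
- exact/measurable_EFinP.
- by move=> x _; rewrite -EFinM lee_fin mulr_ge0// le_max lexx orbT.
- by apply: measurable_funeM; apply/measurable_EFinP; exact: measurable_indic.
rewrite ge0_integralZl_EFin//; last 2 first.
- by apply/measurable_EFinP; exact: measurable_indic.
- by rewrite le_max lexx orbT.
rewrite integral_indic// setIT lte_add_pinfty// lte_mul_pinfty//.
by rewrite lee_fin le_max lexx orbT.
Qed.

End truncation.

(** * Iterates and weighted averages of a Dunford-Schwartz operator *)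

Section dunford_schwartz.
Context {R : realType} {d : measure_display} {Omega : measurableType d}.
Variable mu : {measure set Omega -> \bar R}.
Hypothesis mu_gt0 : (0 < mu setT)%E.
Variable T : (Omega -> R[i]) -> (Omega -> R[i]).
Hypothesis T_ds : dunford_schwartz mu T.
Implicit Types (f g h : Omega -> R[i]) (l M : R).
Local Open Scope ereal_scope.

Lemma iter_L1Linf f k : L1Linf mu f -> L1Linf mu (iter k T f).
Proof. by move=> Lf; elim: k => //= k; exact: ds_maps. Qed.

Lemma iter_cLfun1 f k : cLfun mu 1 f -> cLfun mu 1 (iter k T f) /\
  \int[mu]_x (cmodulus (iter k T f x))%:E <= \int[mu]_x (cmodulus (f x))%:E.
Proof.
move=> f1; elim: k => [//|k [fk1 fkf]] /=.
have := ds_L1 T_ds fk1; rewrite !cLnorm1E => Tk.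
have Tf := le_trans Tk fkf; split=> //; apply/cLfun1P; split.
  exact/(L1Linf_cmeasurable (mu := mu))/(ds_maps T_ds)/cLfun1_L1Linf.
by apply: (le_lt_trans Tf); case/cLfun1P: f1.
Qed.

Lemma iter_cLfuny f M k : cmeasurable f ->
  (\forall x \ae mu, (cmodulus (f x) <= M)%R) ->
  cLfun mu +oo (iter k T f) /\
  \forall x \ae mu, (cmodulus (iter k T f x) <= M)%R.
Proof.
move=> mf fM; elim: k => [|k [fk fkM]] /=.
  by split=> //; apply/(cLfunyP mu_gt0); split=> //; exists M.
have TM : \forall x \ae mu, (cmodulus (T (iter k T f) x) <= M)%R.
  suff /(cLnormyP mu_gt0) : cLnorm mu +oo (T (iter k T f)) <= M%:E.
    by apply: filterS => x; rewrite lee_fin.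
  apply: (le_trans (ds_Linf T_ds fk)); apply/(cLnormyP mu_gt0).
  by apply: filterS fkM => x; rewrite lee_fin.
split=> //; apply/(cLfunyP mu_gt0); split; last by exists M.
exact/(L1Linf_cmeasurable (mu := mu))/(ds_maps T_ds)/cLfuny_L1Linf.
Qed.

Lemma iterD g h k : cLfun mu 1 g -> cLfun mu +oo h ->
  \forall x \ae mu, iter k T (g \+ h)%R x = (iter k T g x + iter k T h x)%R.
Proof.
move=> g1 /[dup] hy /(cLfunyP mu_gt0)[mh [M hM]].
have Lgh : L1Linf mu (g \+ h)%R by exists g, h.
elim: k => [|k IH] /=; first exact: nearW.
have gk1 := (iter_cLfun1 k g1).1; have hky := (iter_cLfuny k mh hM).1.
have Lk : L1Linf mu (iter k T g \+ iter k T h)%R.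
  by exists (iter k T g), (iter k T h).
(* The induction hypothesis is only an equality almost everywhere, so [T] is first moved across it
   by [ds_congr], and linearity is used afterwards. *)
have eqk : iter k T (g \+ h)%R = (iter k T g \+ iter k T h)%R %[ae mu].
  by apply: filterS IH => x.
have := ds_lin T_ds 1%R (cLfun1_L1Linf gk1) (cLfuny_L1Linf hky).
rewrite (_ : (1 \*o _)%R = iter k T g); last by apply/funext => x /=; rewrite mul1r.
move: (ds_congr T_ds (iter_L1Linf k Lgh) Lk eqk).
by apply: filterS2 => x -> // -> //=; rewrite mul1r.
Qed.

Variable beta : nat -> R[i].

Lemma cmeasurable_weighted_average f n : L1Linf mu f ->
  cmeasurable (weighted_average T beta f n).
Proof.
move=> Lf; apply: (cmeasurableM (f := fun=> n%:R^-1%R)).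
  exact: cmeasurable_cst.
apply: cmeasurable_sum => k; apply: (cmeasurableM (f := fun=> beta k)).
  exact: cmeasurable_cst.
exact/(L1Linf_cmeasurable (mu := mu))/iter_L1Linf.
Qed.

Hypothesis beta_le1 : forall k, (cmodulus (beta k) <= 1)%R.

Lemma cmodulus_weighted_average f n x :
  (cmodulus (weighted_average T beta f n x) <=
   n%:R^-1 * \sum_(k < n) cmodulus (iter k T f x))%R.
Proof.
rewrite /weighted_average cmodulusM.
rewrite (_ : (n%:R^-1)%R = ((n%:R^-1 : R)%:C%C : R[i])); last first.
  by rewrite fmorphV rmorph_nat.
rewrite cmodulus_real ger0_norm ?invr_ge0// ler_wpM2l ?invr_ge0//.
rewrite (le_trans (cmodulus_sum _ _))// ler_sum// => k _.
by rewrite cmodulusM ler_piMl ?cmodulus_ge0.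
Qed.

Lemma weighted_average_L1 g n : cLfun mu 1 g ->
  \int[mu]_x (cmodulus (weighted_average T beta g n x))%:E <=
  \int[mu]_x (cmodulus (g x))%:E.
Proof.
move=> g1; have miter k : measurable_fun setT (fun x => (cmodulus (iter k T g x))%:E).
  by apply/measurable_EFinP/measurable_cmodulus; case: (iter_cLfun1 k g1).1.
have mwa : cmeasurable (weighted_average T beta g n).
  exact/cmeasurable_weighted_average/cLfun1_L1Linf.
apply: (@le_trans _ _ (\int[mu]_x
    ((n%:R^-1)%:E * \sum_(k < n) (cmodulus (iter k T g x))%:E))).
  apply: ge0_le_integral => //.
  - by move=> x _; rewrite lee_fin cmodulus_ge0.
  - exact/measurable_EFinP/measurable_cmodulus.
  - by apply: measurable_funeM; exact: emeasurable_sum.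
  by move=> x _; rewrite sumEFin -EFinM lee_fin cmodulus_weighted_average.
rewrite ge0_integralZl_EFin ?invr_ge0//; last 2 first.
- by move=> x _; apply: sume_ge0 => k _; rewrite lee_fin cmodulus_ge0.
- exact: emeasurable_sum.
rewrite ge0_integral_sum//; last by move=> k x _; rewrite lee_fin cmodulus_ge0.
(* The average of order 0 is 0; for positive [n] the factor [n%:R^-1] can be cleared. *)
have [->|n0] := posnP n.
  by rewrite big_ord0 mule0; apply: integral_ge0 => x _; rewrite lee_fin cmodulus_ge0.
rewrite lee_pdivrMl ?ltr0n//.
apply: (@le_trans _ _ (\sum_(k < n) \int[mu]_x (cmodulus (g x))%:E)).
  by apply: lee_sum => k _; exact: (iter_cLfun1 k g1).2.
case/cLfun1P: g1 => _ goo.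
have gfin : \int[mu]_x (cmodulus (g x))%:E \is a fin_num.
  by rewrite ge0_fin_numE// integral_ge0// => x _; rewrite lee_fin cmodulus_ge0.
rewrite -(fineK gfin) sumEFin sumr_const card_ord -EFinM lee_fin.
by rewrite -(mulr_natl (fine _)).
Qed.

Lemma weighted_average_Linf h M : (0 <= M)%R -> cmeasurable h ->
  (\forall x \ae mu, (cmodulus (h x) <= M)%R) ->
  \forall x \ae mu, forall n, (cmodulus (weighted_average T beta h n x) <= M)%R.
Proof.
move=> M0 mh hM.
(* Countably many null sets are merged, so that one exceptional set serves all [n]. *)
have := ae_foralln (fun k => (iter_cLfuny k mh hM).2).
apply: filterS => x hk n; rewrite (le_trans (cmodulus_weighted_average _ _ _))//.
have [->|n0] := posnP n; first by rewrite big_ord0 mulr0.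
rewrite ler_pdivrMl ?ltr0n//.
apply: (@le_trans _ _ (\sum_(k < n) M)%R); first exact: ler_sum.
by rewrite sumr_const card_ord mulr_natl.
Qed.

Lemma weighted_averageD g h : cLfun mu 1 g -> cLfun mu +oo h ->
  \forall x \ae mu, forall n, weighted_average T beta (g \+ h)%R n x =
    (weighted_average T beta g n x + weighted_average T beta h n x)%R.
Proof.
move=> g1 hy; have := ae_foralln (fun k => iterD k g1 hy).
apply: filterS => x ghk n; rewrite /weighted_average -mulrDr -big_split/=.
by congr (_ * _)%R; apply: eq_bigr => k _; rewrite ghk mulrDr.
Qed.

End dunford_schwartz.

(** * The limit of the averages for weights bounded by 1 *)

Section weighted_limit.
Context {R : realType} {d : measure_display} {Omega : measurableType d}.
Variable mu : {measure set Omega -> \bar R}.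
Hypothesis mu_gt0 : (0 < mu setT)%E.
Variable T : (Omega -> R[i]) -> (Omega -> R[i]).
Hypothesis T_ds : dunford_schwartz mu T.
Variable beta : nat -> R[i].
Hypothesis beta_le1 : forall k, cmodulus (beta k) <= 1.
Hypothesis beta_good : good_weight mu T beta.
Implicit Types (f g h : Omega -> R[i]) (l : R).
Local Open Scope ereal_scope.

(** The difference consists of the averages of [f - truncation f l], which is bounded by [l];
    contraction in the supremum norm keeps this bound. *)
Lemma weighted_average_truncation f l : (0 <= l)%R -> cmeasurable f ->
  cLfun mu 1 (truncation f l) ->
  \forall x \ae mu, forall n, (cmodulus (weighted_average T beta f n x -
    weighted_average T beta (truncation f l) n x)%R <= l)%R.
Proof.
move=> l0 mf f1; set g := truncation f l in f1 *.
pose h := (f \- g)%R.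
have mh : cmeasurable h by apply: cmeasurableB => //; exact: f1.1.
have hl : \forall x \ae mu, (cmodulus (h x) <= l)%R.
  by apply: nearW => x; exact: cmodulus_sub_truncation.
have hy : cLfun mu +oo h by apply/(cLfunyP mu_gt0); split=> //; exists l.
have fgh : (g \+ h)%R = f by apply/funext => x; rewrite /h/= addrC subrK.
have := weighted_averageD mu_gt0 T_ds beta f1 hy.
have := weighted_average_Linf mu_gt0 T_ds beta_le1 l0 mh hl.
apply: filterS2 => x hx; rewrite fgh => fx n.
by rewrite fx addrAC subrr add0r.
Qed.

Lemma weighted_average_cvg f : cmeasurable f ->
  (forall l, (0 < l)%R -> cLfun mu 1 (truncation f l)) ->
  \forall x \ae mu, cvgn (fun n => weighted_average T beta f n x : R[i]^o).
Proof.
move=> mf f1.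
(* Only countably many heights are used, so the exceptional sets still have a null union. *)
pose e (m : nat) : R := (m.+1%:R^-1)%R.
have e0 m : (0 < e m)%R by rewrite invr_gt0.
have f1e m := f1 _ (e0 m).
have := ae_foralln (fun m => weighted_average_truncation (ltW (e0 m)) mf (f1e m)).
have := ae_foralln (fun m => beta_good.2 _ (f1e m)).
apply: filterS2 => x gx fx; apply: is_cvg_approx => r r0.
have [m mr] : exists m, (e m <= r)%R.
  exists (Num.bound r^-1); rewrite /e invf_ple ?posrE// ltW//.
  rewrite (lt_le_trans (archi_boundP _)) ?invr_ge0 ?ltW//.
  by rewrite ltr_nat.
exists (fun n => weighted_average T beta (truncation f (e m)) n x) => // n.
exact: le_trans (fx m n) mr.
Qed.

(** The function [g] is the limit of the averages of the truncation: its integral is controlled by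
    Fatou's lemma, its distance to [fhat] by letting [n] tend to infinity. Thus the limit splits at
    the same cost as [f]. *)
Lemma weighted_limit_truncation f fhat l : (0 <= l)%R -> cmeasurable f ->
  cLfun mu 1 (truncation f l) ->
  (\forall x \ae mu,
    weighted_average T beta f n x @[n --> \oo] --> (fhat x : R[i]^o)) ->
  exists2 g, cmeasurable g /\ \int[mu]_x (cmodulus (g x))%:E <=
      \int[mu]_x (cmodulus (truncation f l x))%:E &
    \forall x \ae mu, (cmodulus (fhat x - g x)%R <= l)%R.
Proof.
move=> l0 mf f1 ffhat.
have [g [mg gcvg] gB] := ae_limit_cmeasurable
  (fun n => cmeasurable_weighted_average T_ds beta n (cLfun1_L1Linf f1))
  (beta_good.2 _ f1).
exists g; first by split=> //; apply: gB => n; exact: weighted_average_L1.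
have := weighted_average_truncation l0 mf f1.
apply: filterS3 gcvg ffhat => x gx fx fgl.
have fgx : (cmodulus (weighted_average T beta f n x -
    weighted_average T beta (truncation f l) n x))%R @[n --> \oo] -->
    cmodulus (fhat x - g x)%R.
  by apply: cvg_cmodulus; exact: cvg_complexB.
rewrite -(cvg_lim (@Rhausdorff R) fgx).
by apply: limr_le; [exact: cvgP fgx|exact: nearW].
Qed.

Lemma weighted_limit_submajorized f : L1Linf mu f ->
  (forall l, (0 < l)%R -> mu [set x | (l < cmodulus (f x))%R] < +oo) ->
  exists2 fhat, L1Linf mu fhat /\ submajorized mu fhat f &
    \forall x \ae mu,
      weighted_average T beta f n x @[n --> \oo] --> (fhat x : R[i]^o).
Proof.
move=> Lf foo; have mf := L1Linf_cmeasurable Lf.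
have f1 l : (0 < l)%R -> cLfun mu 1 (truncation f l).
  by move=> l0; apply: cLfun1_truncation => //; [exact: ltW|exact: foo].
have [fhat [mfhat ffhat] _] := ae_limit_cmeasurable
  (fun n => cmeasurable_weighted_average T_ds beta n Lf)
  (weighted_average_cvg mf f1).
exists fhat => //; split.
  (* Any positive height would do here; 1 is chosen to see that the limit lies in [L1Linf]. *)
  have [g [mg gf] gl] :=
    weighted_limit_truncation ler01 mf (f1 _ ltr01) ffhat.
  exists g, (fhat \- g)%R; split.
  - apply/cLfun1P; split=> //; apply: (le_lt_trans gf).
    by have /cLfun1P[] := f1 _ ltr01.
  - apply/(cLfunyP mu_gt0); split; first exact: cmeasurableB.
    by exists 1%R.
  - by apply/funext => x /=; rewrite addrC subrK.
move=> s s0; set I := (leRHS).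
have [->|Ioo] := eqVneq I +oo; first by rewrite leey.
(* An infinite value at [s] would, by monotonicity, make the rearrangement infinite on all of []0,
   s]], and so its integral. *)
have [l fs] : exists l, rearrangement mu f s = l%:E.
  have := rearrangement_ge0 mu f s.
  case fs : (rearrangement mu f s) => [l| |]//; first by exists l.
  move/eqP: Ioo; case; apply/eqP; rewrite -leye_eq.
  apply: (@le_trans _ _ (\int[lebesgue_measure]_(t in `]0%R, s]) cst +oo t)).
    rewrite integral_cst//= lebesgue_measure_itv/= lte_fin s0 oppr0 adde0.
    by rewrite gt0_mulye.
  apply: ge0_le_integral => //; first by move=> t _; rewrite /= leey.
  - exact: measurable_rearrangement.
  - move=> t; rewrite /= in_itv/= => /andP[_ ts].
    by rewrite -fs; exact: rearrangement_nonincreasing.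
have l0 : (0 <= l)%R by rewrite -lee_fin -fs rearrangement_ge0.
have fI := truncation_le_integral_rearrangement mf s0 fs.
have truncE : \int[mu]_x (Num.max (cmodulus (f x) - l) 0)%:E =
    \int[mu]_x (cmodulus (truncation f l x))%:E.
  by apply: eq_integral => x _; rewrite cmodulus_truncation.
rewrite truncE -/I in fI.
(* The height [l] may be 0, which [f1] does not cover; integrability comes from the finiteness of
   [I] instead. *)
have fl1 : cLfun mu 1 (truncation f l).
  apply/cLfun1P; split; first exact: cmeasurable_truncation.
  apply: (@le_lt_trans _ _ I); last by rewrite ltey.
  by apply: le_trans fI; rewrite leeDl// lee_fin mulr_ge0// ltW.
have [g [mg gf] gl] := weighted_limit_truncation l0 mf fl1 ffhat.
apply: (@le_trans _ _ (\int[mu]_x (cmodulus (g x))%:E + (s * l)%:E)); last first.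
  by apply: (le_trans _ fI); rewrite leeD2r.
apply: integral_rearrangement_le => //; apply: filterS gl => x gl.
rewrite addrC -lerBlDr (le_trans _ gl)// lerBlDr.
by rewrite (le_trans _ (cmodulusD _ _))// subrK.
Qed.

End weighted_limit.

(** * Fully symmetric spaces without the constant 1 *)

Section fully_symmetric.
Context {R : realType} {d : measure_display} {Omega : measurableType d}.
Variable mu : {measure set Omega -> \bar R}.
Hypothesis mu_gt0 : (0 < mu setT)%E.
Variables (E : set (Omega -> R[i])) (normE : (Omega -> R[i]) -> R).
Hypothesis E_fs : fully_symmetric mu E normE.

Lemma fully_symmetricZ (a : R[i]) f : E f -> E (a \*o f).
Proof.
move=> Ef; have := bs_lin E_fs.1 a Ef (bs_zero E_fs.1).
by rewrite (_ : _ \+ _ = a \*o f)//; apply/funext => x /=; rewrite addr0.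
Qed.

(* If |f| exceeds l on a set of infinite measure, then the constant l is
   submajorized by f. *)
Lemma fully_symmetric_lt_pinfty f (l : R) : E f -> ~ E (fun=> 1) -> 0 < l ->
  (mu [set x | (l < cmodulus (f x))%R] < +oo)%E.
Proof.
move=> Ef E1 l0; rewrite ltey; apply/eqP => foo; apply: E1.
have mf := L1Linf_cmeasurable (bs_sub E_fs.1 Ef).
have lE : cmodulus l%:C%C = l by rewrite cmodulus_real ger0_norm// ltW.
have ml : cmeasurable (fun _ : Omega => l%:C%C) by exact: cmeasurable_cst.
have Ll : L1Linf mu (fun=> l%:C%C).
  apply/cLfuny_L1Linf/(cLfunyP mu_gt0); split=> //; exists l.
  by apply: nearW => x; rewrite lE.
have lf : submajorized mu (fun=> l%:C%C) f.
  move=> s s0; apply: ge0_le_integral => //.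
  - by move=> t _; exact: rearrangement_ge0.
  - exact: measurable_rearrangement.
  - exact: measurable_rearrangement.
  (* At every [t > 0] the rearrangement of the constant is at most [l], while that of [f] is at
     least [l], the superlevel set having infinite measure. *)
  - move=> t; rewrite /= in_itv/= => /andP[t0 _].
    apply: (@le_trans _ _ l%:E).
      apply: rearrangement_le => //; rewrite (_ : [set x | _] = set0).
        by rewrite measure0 lee_fin ltW.
      by apply/seteqP; split=> x //; rewrite /mkset lE ltxx.
    by apply: rearrangement_ge => //; rewrite foo ltry.
have [El _] := E_fs.2 _ _ Ef Ll lf.
have := fully_symmetricZ (l^-1)%:C%C El.
rewrite (_ : _ \*o _ = fun=> 1)//; apply/funext => x /=.
by rewrite -rmorphM mulVf ?rmorph1// gt_eqF.
Qed.

End fully_symmetric.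

(** * Rescaling of the weights and conclusion *)

Lemma weighted_averageZ (R : realType) (d : measure_display)
  (Omega : measurableType d) (T : (Omega -> R[i]) -> (Omega -> R[i]))
  (c : R[i]) (beta : nat -> R[i]) f n x :
  weighted_average T (c \*o beta) f n x = c * weighted_average T beta f n x.
Proof.
rewrite /weighted_average mulrCA; congr (_ * _); rewrite mulr_sumr.
by apply: eq_bigr => k _; rewrite /= mulrA.
Qed.

Theorem theorem5p3 (R : realType) (d : measure_display)
  (Omega : measurableType d) (mu : {measure set Omega -> \bar R})
  (mu_complete : measure_is_complete mu) (mu_infinite : mu setT = +oo%E)
  (T : (Omega -> R[i]) -> (Omega -> R[i])) (T_ds : dunford_schwartz mu T)
  (beta : nat -> R[i]) (beta_good : good_weight mu T beta)
  (E : set (Omega -> R[i])) (normE : (Omega -> R[i]) -> R)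
  (E_fs : fully_symmetric mu E normE) (E_one : ~ E (fun=> 1))
  (f : Omega -> R[i]) (Ef : E f) :
  exists2 fhat : Omega -> R[i], E fhat &
    \forall x \ae mu,
      weighted_average T beta f n x @[n --> \oo] --> (fhat x : R[i]^o).
Proof.
have mu_gt0 : (0 < mu setT)%E by rewrite mu_infinite ltry.
have [[C beta_C] beta_cvg] := beta_good.
(* The maximum with 1 makes the bound positive, so that the weights can be divided by it; the limit
   is multiplied by [c] at the end. *)
pose c := Num.max C 1.
have c0 : 0 < c by rewrite lt_max ltr01 orbT.
pose beta' : nat -> R[i] := (c^-1)%:C%C \*o beta.
have beta'_le1 k : cmodulus (beta' k) <= 1.
  rewrite /beta'/= cmodulusM cmodulus_real ger0_norm; last first.
    by rewrite invr_ge0 ltW.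
  rewrite ler_pdivrMl// mulr1 (le_trans (beta_C k))//.
  by rewrite /c le_max lexx.
have beta'_good : good_weight mu T beta'.
  split; first by exists 1.
  move=> g /beta_cvg; apply: filterS => x /cvg_ex[l gl].
  apply/cvg_ex; exists ((c^-1)%:C%C * l).
  by under eq_fun do rewrite weighted_averageZ; exact: cvg_complexZ.
have [fhat [Lfhat fhatf] fcvg] := weighted_limit_submajorized mu_gt0 T_ds
  beta'_le1 beta'_good (bs_sub E_fs.1 Ef)
  (fun l l0 => fully_symmetric_lt_pinfty mu_gt0 E_fs Ef E_one l0).
have [Efhat _] := E_fs.2 _ _ Ef Lfhat fhatf.
exists (c%:C%C \*o fhat); first exact: fully_symmetricZ E_fs _ _ Efhat.
apply: filterS fcvg => x fx.
have := cvg_complexZ (c := c%:C%C) fx.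
rewrite [X in X @ _ --> _ -> _](_ : _ = fun n => weighted_average T beta f n x)//.
apply/funext => n /=; rewrite weighted_averageZ mulrA -rmorphM.
by rewrite mulfV ?rmorph1 ?mul1r// gt_eqF.
Qed.
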